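(* Let $T$ be any complete countable first-order theory with monster model $\mathcal U$. Let $p$ be a global type which is invariant over some small model and has dp-rank $1$. Then $p$ is either finitely satisfiable in some small model, or definable over some small model.
   Context: Global types are complete types over $\mathcal U$; realizations of global types are taken in an elementary extension of $\mathcal U$; ''small'' means of cardinality less than the saturation of $\mathcal U$. A global type $p(x)$ is $M$-invariant if for every formula $\phi(x;y)$ and all $b,b'\in\mathcal U$ with $b\equiv_M b'$ we have $p\vdash\phi(x;b)\leftrightarrow\phi(x;b')$. It is finitely satisfiable in $M$ if every formula in $p$ has a realization in $M$, and definable over $A$ if for every $\phi(x;y)\in L$ there is $\psi(y)\in L(A)$ such that for all $b\in\mathcal U$, $p\vdash\phi(x;b)$ iff $\models\psi(b)$. A partial type $\pi$ over a set $A$ has dp-rank $\le n$ if for every realization $a$ of $\pi$ and any sequences $I_0,\dots,I_{n-1}$ that are mutually indiscernible over $A$, there is $k<n$ such that $I_k$ is indiscernible over $Aa$ (this does not depend on the choice of the parameter set $A$); ''dp-rank $1$'' means dp-rank $\le 1$. *)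

(* Defs.v *)
From mathcomp Require Import all_boot all_order.
From mathcomp Require Import boolp classical_sets functions cardinality.

Set Implicit Arguments.
Unset Strict Implicit.
Unset Printing Implicit Defensive.

Local Open Scope classical_set_scope.
Local Open Scope card_scope.

Record language := Language {
  fun_sym : Type;
  fun_ar : fun_sym -> nat;
  rel_sym : Type;
  rel_ar : rel_sym -> nat }.

Definition countable_language (L : language) : Prop :=
  countable [set: fun_sym L] /\ countable [set: rel_sym L].

Inductive term (L : language) (V : Type) : Type :=
| Var (x : V)
| App (f : fun_sym L) (ts : 'I_(fun_ar f) -> term L V).

(** [formula L V] is the type of first-order formulas with free variables in
    [V]; in [All phi] the variable [None] of [phi] is the bound one.
    An L(C)-formula in the variables [V] is a [formula L (V + C)]: the
    parameters are the free variables in [C], and the assignment fixes them. *)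
Inductive formula (L : language) (V : Type) : Type :=
| Bot
| Equal (s t : term L V)
| Atom (r : rel_sym L) (ts : 'I_(rel_ar r) -> term L V)
| Imp (phi psi : formula L V)
| All (phi : formula L (option V)).

Arguments Var {L V} x.
Arguments App {L V} f ts.
Arguments Bot {L V}.
Arguments Equal {L V} s t.
Arguments Atom {L V} r ts.
Arguments Imp {L V} phi psi.
Arguments All {L V} phi.

Definition Neg L (V : Type) (phi : formula L V) : formula L V := Imp phi Bot.
Definition And L (V : Type) (phi psi : formula L V) : formula L V :=
  Neg (Imp phi (Neg psi)).
Definition Iff L (V : Type) (phi psi : formula L V) : formula L V :=
  And (Imp phi psi) (Imp psi phi).

Fixpoint rename_term L (V W : Type) (f : V -> W) (t : term L V) : term L W :=
  match t with
  | Var x => Var (f x)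
  | App g ts => App g (fun i => rename_term f (ts i))
  end.

Fixpoint rename L (V W : Type) (f : V -> W) (phi : formula L V) : formula L W :=
  match phi with
  | Bot => Bot
  | Equal s t => Equal (rename_term f s) (rename_term f t)
  | Atom r ts => Atom r (fun i => rename_term f (ts i))
  | Imp phi psi => Imp (rename f phi) (rename f psi)
  | All phi => All (rename (omap f) phi)
  end.

(** The formula phi(x; b), for an L-formula phi(x; y). *)
Definition plug L (V W C : Type) (phi : formula L (V + W)) (b : W -> C) :
    formula L (V + C) :=
  rename (fun s => match s with inl x => inl x | inr y => inr (b y) end) phi.

Record structure (L : language) := Structure {
  carrier :> Type;
  carrier_inhabited : inhabited carrier;
  fun_interp : forall f : fun_sym L, ('I_(fun_ar f) -> carrier) -> carrier;
  rel_interp : forall r : rel_sym L, ('I_(rel_ar r) -> carrier) -> Prop }.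

Fixpoint eval L (M : structure L) (V : Type) (v : V -> M) (t : term L V) : M :=
  match t with
  | Var x => v x
  | App f ts => fun_interp (fun i => eval v (ts i))
  end.

Definition extend (X V : Type) (x : X) (v : V -> X) (o : option V) : X :=
  if o is Some y then v y else x.

Fixpoint sat L (M : structure L) (V : Type) (phi : formula L V) : (V -> M) -> Prop :=
  match phi with
  | Bot => fun=> False
  | Equal s t => fun v => eval v s = eval v t
  | Atom r ts => fun v => rel_interp (fun i => eval v (ts i))
  | Imp phi psi => fun v => sat phi v -> sat psi v
  | All phi => fun v => forall x : M, sat phi (extend x v)
  end.

Definition assign (X V C : Type) (v : V -> X) (c : C -> X) (s : V + C) : X :=
  match s with inl x => v x | inr y => c y end.

Definition theory (L : language) := set (formula L void).

Definition models L (M : structure L) (T : theory L) : Prop :=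
  forall phi, T phi -> sat phi (of_void M).

Definition entails L (T : theory L) (phi : formula L void) : Prop :=
  forall M : structure L, models M T -> sat phi (of_void M).

Definition complete_theory L (T : theory L) : Prop :=
  (exists M : structure L, models M T) /\
  (forall phi, entails T phi \/ entails T (Neg phi)).

(** [(M, c)] and [(N, d)] are elementarily equivalent as L(C)-structures. *)
Definition elem_equiv L (M N : structure L) (C : Type) (c : C -> M) (d : C -> N) : Prop :=
  forall phi : formula L C, sat phi c <-> sat phi d.

(** [(M, id)] and [(N, e)] satisfy the same L(M)-sentences. *)
Definition elementary_embedding L (M N : structure L) (e : M -> N) : Prop :=
  elem_equiv (fun x : M => x) e.

Definition elementary_substructure L (U : structure L) (M : set U) : Prop :=
  exists (N : structure L) (e : N -> U),
    elementary_embedding e /\ range e = M.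

Definition automorphism L (U : structure L) (s : U -> U) : Prop :=
  [/\ bijective s,
      forall f (v : 'I_(fun_ar f) -> U),
        s (fun_interp v) = fun_interp (fun i => s (v i))
    & forall r (v : 'I_(rel_ar r) -> U),
        rel_interp v <-> rel_interp (fun i => s (v i))].

(** [v] and [w] have the same type over [A]. *)
Definition same_type L (U : structure L) (A : set U) (V : Type) (v w : V -> U) : Prop :=
  elem_equiv (assign v (fun a : A => val a)) (assign w (fun a : A => val a)).

(** Complete types in the variables [V] over the parameters [c]: sets of
    L(C)-formulas which are finitely satisfiable in [U] (equivalently, consistent
    with the L(C)-theory of [U]) and decide every L(C)-formula. *)
Definition complete_type L (U : structure L) (V C : Type) (c : C -> U)
    (p : set (formula L (V + C))) : Prop :=
  (forall F : set (formula L (V + C)), F `<=` p -> finite_set F ->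
     exists v : V -> U, forall phi, F phi -> sat phi (assign v c)) /\
  (forall phi, p phi \/ p (Neg phi)).

(** A cardinal is given by a type [K] of that cardinality. *)
Definition small (K T : Type) (A : set T) : Prop :=
  A #<= [set: K] /\ ~ ([set: K] #<= A).

Definition strong_limit (K : Type) : Prop :=
  forall X : Type, small K [set: X] -> small K [set: set X].

Definition saturated (K : Type) L (U : structure L) : Prop :=
  forall (A : set U) n (p : set (formula L ('I_n + A))),
    small K A -> complete_type (fun a : A => val a) p ->
    exists v : 'I_n -> U,
      forall phi, p phi -> sat phi (assign v (fun a : A => val a)).

Definition strongly_homogeneous (K : Type) L (U : structure L) : Prop :=
  forall (A : set U) (f : A -> U),
    small K A -> elem_equiv (fun a : A => val a) f ->
    exists s : U -> U, automorphism s /\ forall a : A, s (val a) = f a.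

(** [K] is the saturation kappa of [U]: an uncountable strong limit, as usual for
    the sufficiently large cardinal in the definition of a monster model. *)
Record monster (K : Type) L (U : structure L) : Prop := {
  monster_uncountable : small K [set: nat];
  monster_strong_limit : strong_limit K;
  monster_saturated : saturated K U;
  monster_homogeneous : strongly_homogeneous K U }.

Definition small_model (K : Type) L (U : structure L) (M : set U) : Prop :=
  small K M /\ elementary_substructure M.

(** A global type [p] is complete, so below [p |- phi] is written as [phi] being
    an element of [p]. *)

Definition global_type L (U : structure L) n
    (p : set (formula L ('I_n + U))) : Prop :=
  complete_type (fun u : U => u) p.

Definition invariant_over L (U : structure L) (M : set U) n
    (p : set (formula L ('I_n + U))) : Prop :=
  forall m (phi : formula L ('I_n + 'I_m)) (b b' : 'I_m -> U),
    same_type M b b' -> p (Iff (plug phi b) (plug phi b')).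

Definition finitely_satisfiable_in L (U : structure L) (M : set U) n
    (p : set (formula L ('I_n + U))) : Prop :=
  forall phi, p phi -> exists v : 'I_n -> U,
    (forall i, M (v i)) /\ sat phi (assign v (fun u : U => u)).

Definition definable_over L (U : structure L) (A : set U) n
    (p : set (formula L ('I_n + U))) : Prop :=
  forall m (phi : formula L ('I_n + 'I_m)),
  exists psi : formula L ('I_m + A), forall b : 'I_m -> U,
    p (plug phi b) <-> sat psi (assign b (fun a : A => val a)).

(** A sequence of [m]-tuples indexed by [J] is a map [J -> 'I_m -> N]. The free
    variables ['I_k * 'I_m] stand for [k] of its terms. *)
Definition indiscernible L (N : structure L) (A : set N)
    (d : Order.disp_t) (J : orderType d) m (I : J -> 'I_m -> N) : Prop :=
  forall k (i j : 'I_k -> J),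
    (forall x y : 'I_k, (x < y)%N -> (i x < i y)%O) ->
    (forall x y : 'I_k, (x < y)%N -> (j x < j y)%O) ->
    same_type A (fun xl : 'I_k * 'I_m => I (i xl.1) xl.2)
                (fun xl : 'I_k * 'I_m => I (j xl.1) xl.2).

Definition entries (X J : Type) m (I : J -> 'I_m -> X) : set X :=
  [set y | exists i l, y = I i l].

Definition mutually_indiscernible L (N : structure L) (A : set N) r
    (d : Order.disp_t) (J : 'I_r -> orderType d) (m : 'I_r -> nat)
    (I : forall k, J k -> 'I_(m k) -> N) : Prop :=
  forall k, indiscernible
    (A `|` \bigcup_(l in [set l | l != k]) entries (I l)) (I k).

(** dp-rank at most [r], computed over the parameter set [U], with the usual
    count of [r + 1] sequences (with only [r] of them, rank at most 1 would mean
    that [p] is realized in [U]). The sequences are infinite, with terms of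
    finite length; the elements and sequences live in elementary extensions. *)
Definition dp_rank_le (r : nat) L (U : structure L) n
    (p : set (formula L ('I_n + U))) : Prop :=
  forall (N : structure L) (e : U -> N), elementary_embedding e ->
  forall a : 'I_n -> N, (forall phi, p phi -> sat phi (assign a e)) ->
  forall (d : Order.disp_t) (J : 'I_r.+1 -> orderType d) (m : 'I_r.+1 -> nat)
         (I : forall k, J k -> 'I_(m k) -> N),
    (forall k, infinite_set [set: J k]) ->
    mutually_indiscernible (range e) I ->
    exists k, indiscernible (range e `|` range a) (I k).

(* Main.v *)
(** Suppose that [p] is invariant over [M], not definable over [M], and not
    finitely satisfiable in a small model [N0] containing [M] in which every
    finitary type over [M] is realized.

    The set of [b] with [phi(x; b)] in [p] is, for some [phi], not clopen in the
    space of types over [M]; a boundary point gives an ultrafilter [Q] on tuples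
    of [N0] such that [phi(x; b)] is in [p] for [b] realizing [Q] over [M], but
    [phi(x; b')] is not in [p] for [Q]-almost all [b']. So [p] and [Q] do not
    commute. Some [psi(x; c)] in [p] has no realization in [N0]; since [N0]
    realizes all types over [M], there is an ultrafilter [D] containing the type
    of [c] over [M] such that every [u] in [U] satisfies [~ psi(u; y)] for
    [D]-almost all [y].

    Choose successively [..., y_2, y_1] generic for [D], then a triple
    [(x, y_0, z_0)] generic for an ultrafilter on [U], then [z_1, z_2, ...]
    generic for [Q]. The triple can be chosen such that [x] realizes [p],
    [psi(x; y_0)] and [phi(x; z_0)] hold and [(y_0, z_0)] is generic for [D] then
    [Q]. The sequences [y] and [z] are mutually indiscernible over [U], and
    neither is indiscernible over [x], because of [~ psi(x; y_1)] and
    [~ phi(x; z_1)]: [x] has dp-rank at least 2. *)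

Require Import Defs.
From mathcomp Require Import all_boot all_order.
From mathcomp Require Import boolp classical_sets functions cardinality.
From mathcomp Require Import filter.

Set Implicit Arguments.
Unset Strict Implicit.
Unset Printing Implicit Defensive.

Local Open Scope classical_set_scope.
Local Open Scope card_scope.

(** * First-order syntax *)

Lemma ex2P T (P Q : T -> Prop) : (exists2 x, P x & Q x) -> exists x, P x /\ Q x.
Proof. by move=> [x ? ?]; exists x. Qed.

Section Syntax.
Variable L : language.

Lemma eval_rename (U : structure L) (V W : Type) (f : V -> W) (t : term L V)
  (v : W -> U) : eval v (rename_term f t) = eval (v \o f) t.
Proof. by elim: t => //= h ts IH; congr fun_interp; apply/funext => i; exact: IH. Qed.

Lemma extend_omap (X V W : Type) (x : X) (v : W -> X) (f : V -> W) :
  extend x v \o omap f = extend x (v \o f).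
Proof. by apply/funext => -[]. Qed.

Lemma sat_rename (U : structure L) (V W : Type) (f : V -> W) (phi : formula L V)
  (v : W -> U) : sat (rename f phi) v = sat phi (v \o f).
Proof.
elim: phi W f v => //= {V}.
- by move=> V s t W f v; rewrite !eval_rename.
- move=> V r ts W f v; congr rel_interp.
  by apply/funext => i; rewrite eval_rename.
- by move=> V phi IH1 psi IH2 W f v; rewrite IH1 IH2.
- move=> V phi IH W f v; apply/propext.
  by split=> H x; move: (H x); rewrite IH extend_omap.
Qed.

Lemma sat_All (U : structure L) V (phi : formula L (option V)) (v : V -> U) :
  sat (All phi) v = forall x, sat phi (extend x v).
Proof. by []. Qed.

Lemma satN (U : structure L) V (phi : formula L V) (v : V -> U) :
  sat (Neg phi) v = ~ sat phi v.
Proof. by []. Qed.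

Lemma sat_And (U : structure L) V (phi psi : formula L V) (v : V -> U) :
  sat (And phi psi) v = (sat phi v /\ sat psi v).
Proof.
apply/propext => /=; split; last by move=> [? ?]; apply.
by move=> H; split; apply: contrapT => N; apply: H => // ? ?; exact: N.
Qed.

Definition Or V (phi psi : formula L V) := Imp (Neg phi) psi.

Lemma sat_Or (U : structure L) V (phi psi : formula L V) (v : V -> U) :
  sat (Or phi psi) v = (sat phi v \/ sat psi v).
Proof.
apply/propext => /=; split; last by case.
by case: (pselect (sat phi v)); [left|right; auto].
Qed.

Lemma assign_comp (X V V' C C' : Type) (f : V -> V') (g : C -> C')
    (v : V' -> X) (c : C' -> X) :
  assign v c \o (fun s => match s with inl x => inl (f x) | inr y => inr (g y) end)
  = assign (v \o f) (c \o g).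
Proof. by apply/funext => -[]. Qed.

Lemma sat_plug (U : structure L) (V W C : Type) (phi : formula L (V + W))
    (b : W -> C) (v : V -> U) (c : C -> U) :
  sat (plug phi b) (assign v c) = sat phi (assign v (c \o b)).
Proof. by rewrite sat_rename (assign_comp id). Qed.

(** Quantifying over every [g] that covers [S] lets the induction pass a binder: the support is
    pulled back along [Some], and [omap g] always covers the bound [None]. *)
Lemma finite_support (V : Type) (phi : formula L V) :
  exists S : set V, finite_set S /\ forall (W : Type) (g : W -> V),
    S `<=` range g -> exists phi0, phi = rename g phi0.
Proof.
have tm V' (t : term L V') : exists S : set V', finite_set S /\
    forall (W : Type) (g : W -> V'),
    S `<=` range g -> exists t0, t = rename_term g t0.
  elim: t => [x|h ts IH].
    exists [set x]; split; first exact: finite_set1.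
    by move=> W g /(_ x erefl)[w _ <-]; exists (Var w).
  have [S SP] := choice (fun i => IH i).
  exists (\bigcup_(i in [set: 'I_(fun_ar h)]) S i); split.
    by apply: bigcup_finite => [|i _]; [exact: finite_finset|case: (SP i)].
  move=> W g Sg.
  have [t tP] := choice (fun i =>
    proj2 (SP i) W g (fun x Sx => Sg x (ex_intro2 _ _ i I Sx))).
  by exists (App h t) => /=; congr App; apply/funext.
elim: phi => {V} [V|V s t|V r ts|V phi IH1 psi IH2|V phi [S [fS SP]]].
- by exists set0; split => // W g _; exists Bot.
- have [[S [fS SP]] [S' [fS' SP']]] := (tm V s, tm V t).
  exists (S `|` S'); split; first by rewrite finite_setU.
  move=> W g; rewrite subUset => -[/SP[s' ->] /SP'[t' ->]].
  by exists (Equal s' t').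
- have [S SP] := choice (fun i => tm V (ts i)).
  exists (\bigcup_(i in [set: 'I_(rel_ar r)]) S i); split.
    by apply: bigcup_finite => [|i _]; [exact: finite_finset|case: (SP i)].
  move=> W g Sg.
  have [t tP] := choice (fun i =>
    proj2 (SP i) W g (fun x Sx => Sg x (ex_intro2 _ _ i I Sx))).
  by exists (Atom r t) => /=; congr Atom; apply/funext.
- have [[S [fS SP]] [S' [fS' SP']]] := (IH1, IH2).
  exists (S `|` S'); split; first by rewrite finite_setU.
  move=> W g; rewrite subUset => -[/SP[s' ->] /SP'[t' ->]].
  by exists (Imp s' t').
- exists (Some @^-1` S); split.
    by apply: finite_preimage => // x y _ _ [].
  move=> W g Sg; have [|phi0 ->] := SP _ (omap g); last by exists (All phi0).
  move=> [x /Sg[w _ <-]|_]; first by exists (Some w).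
  by exists None.
Qed.

Lemma finite_range (V : Type) (S : set V) : finite_set S ->
  exists k (w : 'I_k -> V), S = range w.
Proof.
move=> /finite_setP[k] /card_set_bijP [f [ff fi fs]].
have [w wP] := choice (fun i : 'I_k => ex2P (fs i (ltn_ord i))).
exists k, w; apply/seteqP; split => x; last by move=> [i _ <-]; case: (wP i).
move=> Sx; exists (Ordinal (ff x Sx)) => //; have [Sw fw] := wP (Ordinal (ff x Sx)).
by apply: fi; rewrite ?inE.
Qed.

Lemma finite_support_plug (V C : Type) (phi : formula L (V + C)) :
  exists k (b : 'I_k -> C) (phi0 : formula L (V + 'I_k)), phi = plug phi0 b.
Proof.
have [S [fS SP]] := finite_support phi.
have fS' : finite_set (@inr V C @^-1` S).
  by apply: finite_preimage => // x y _ _ [].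
have [k [b Sb]] := finite_range fS'; exists k, b; apply: SP => -[x|y] Sxy.
  by exists (inl x).
have : (@inr V C @^-1` S) y by [].
by rewrite Sb => -[i _ <-]; exists (inr i).
Qed.

Fixpoint allb n V : formula L ('I_n + V) -> formula L V :=
  match n with
  | 0 => rename (fun s : 'I_0 + V => match s with
           inl i => False_rect _ (notF (ltn_ord i)) | inr x => x end)
  | n'.+1 => fun phi => allb (All (rename (fun s : 'I_n'.+1 + V =>
       match s with
       | inl i => if unlift ord0 i is Some j then Some (inl j) else None
       | inr x => Some (inr x) end) phi))
  end.

Lemma sat_allb (U : structure L) n V (phi : formula L ('I_n + V)) (v : V -> U) :
  sat (allb phi) v <-> forall x : 'I_n -> U, sat phi (assign x v).
Proof.
elim: n phi => [|n IH] phi /=.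
  have E (x : 'I_0 -> U) : v \o (fun s : 'I_0 + V => match s with
      inl i => False_rect _ (notF (ltn_ord i)) | inr x => x end) = assign x v.
    by apply/funext => -[[]|].
  rewrite sat_rename; split=> [H x|H]; first by rewrite -E.
  have x : 'I_0 -> U by case.
  by rewrite (E x).
rewrite IH; split=> H x; last (rewrite sat_All => u).
  have := H (fun j => x (lift ord0 j)).
  rewrite sat_All => /(_ (x ord0)); rewrite sat_rename.
  congr (sat phi _); apply/funext => -[i|//] /=.
  by case: unliftP => [j|] ->.
rewrite sat_rename.
have := H (fun i => if unlift ord0 i is Some j then x j else u).
congr (sat phi _); apply/funext => -[i|//] /=.
by case: unliftP.
Qed.

Definition exb n V (phi : formula L ('I_n + V)) : formula L V := Neg (allb (Neg phi)).

Lemma sat_exb (U : structure L) n V (phi : formula L ('I_n + V)) (v : V -> U) :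
  sat (exb phi) v <-> exists x : 'I_n -> U, sat phi (assign x v).
Proof.
rewrite satN sat_allb; split.
  by move=> H; apply: contrapT => N; apply: H => x Hx; apply: N; exists x.
by move=> [x Hx] H; exact: (H x Hx).
Qed.

End Syntax.

(** * Ultrafilters as quantifiers *)

(** An ultrafilter read as the quantifier [for almost all]. The third clause gives properness and
    maximality at once, and makes the quantifier commute with negation. *)
Definition ultra T (F : set (set T)) : Prop :=
  [/\ forall A B : set T, A `<=` B -> F A -> F B,
      forall A B : set T, F A -> F B -> F (A `&` B)
    & forall A : set T, F (~` A) <-> ~ F A].

Section Ultra.
Variables (T : Type) (F : set (set T)).
Hypothesis uF : ultra F.

Lemma ultraS A B : (forall x, A x -> B x) -> F A -> F B.
Proof. by case: uF => H _ _; exact: H. Qed.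

Lemma ultraI (A B : set T) : F A -> F B -> F (fun x => A x /\ B x).
Proof. by case: uF => _ H _; exact: H. Qed.

Lemma ultraN (A : set T) : F (fun x => ~ A x) <-> ~ F A.
Proof. by case: uF => _ _; apply. Qed.

Lemma ultra_true (A : set T) : (forall x, A x) -> F A.
Proof.
move=> H; have [//|/ultraN] := pselect (F A).
by apply: ultraS => x; have := H x.
Qed.

Lemma ultra_ex (A : set T) : F A -> exists x, A x.
Proof.
move=> FA; apply: contrapT => N; have /ultraN : F (fun x => ~ A x).
  by apply: ultra_true => x Ax; apply: N; exists x.
exact.
Qed.

Lemma ultra_const (P : Prop) : F (fun=> P) <-> P.
Proof. by split=> [/ultra_ex[]//|p]; exact: ultra_true. Qed.

Lemma ultra_imp (A B : set T) : F (fun x => A x -> B x) <-> (F A -> F B).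
Proof.
split=> [H FA|H].
  by apply: ultraS (ultraI H FA) => x [h /h].
have [/H FB|/ultraN] := pselect (F A); first exact: ultraS FB.
by apply: ultraS => x nAx /nAx.
Qed.

Lemma ultra_and (A B : set T) : F (fun x => A x /\ B x) <-> F A /\ F B.
Proof.
by split=> [H|[]]; [split; apply: ultraS H => x []|exact: ultraI].
Qed.

Lemma ultra_iff (A B : set T) : F (fun x => A x <-> B x) <-> (F A <-> F B).
Proof. by rewrite ultra_and !ultra_imp. Qed.

Lemma ultra_congr (A B : set T) : (forall x, A x <-> B x) -> F A <-> F B.
Proof. by move=> H; apply/ultra_iff/ultra_true. Qed.

End Ultra.

Lemma ultra_extend T (F : set (set T)) :
  F setT -> (forall A B, F A -> F B -> F (A `&` B)) ->
  (forall A, F A -> exists x, A x) ->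
  exists G, ultra G /\ F `<=` G.
Proof.
move=> FT FI F0; pose F' := [set B : set T | exists2 A, F A & A `<=` B].
have FF' : ProperFilter F'.
  split; first by move=> [A /F0[x Ax] /(_ x Ax)].
  split; first by exists setT.
  - move=> P Q [A FA AP] [B FB BQ]; exists (A `&` B); first exact: FI.
    exact: setISS.
  - by move=> P Q PQ [A FA AP]; exists A => //; exact: subset_trans PQ.
have [G [uG FG]] := ultraFilterLemma FF'.
exists G; split; last by move=> A FA; apply: FG; exists A.
split=> [A B|A B|A]; [exact: filterS|exact: filterI|].
split=> [GnA GA|nGA]; last by case: (in_ultra_setVsetC A uG).
by have /filter_ex[x []] : G (A `&` ~` A) by exact: filterI.
Qed.

(** This is the iteration behind products of ultrafilters; [G] may depend on the element drawn from
    [F]. *)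
Lemma ultra_bind T T' (F : set (set T)) (G : T -> set (set T')) :
  ultra F -> (forall x, ultra (G x)) -> ultra [set W | F (fun x => G x W)].
Proof.
move=> uF uG; split => [A B AB|A B|A] /=.
- by apply: ultraS => // x; exact: (ultraS (uG x)).
- by move=> FA FB; apply: ultraS (ultraI uF FA FB) => // x []; exact: (ultraI (uG x)).
- by rewrite -ultraN //; apply: ultra_congr => // x; exact: (ultraN (uG x)).
Qed.

Lemma ultra_preimage T T' (f : T -> T') (F : set (set T)) :
  ultra F -> ultra [set W | F (f @^-1` W)].
Proof.
move=> uF; split => [A B AB|A B|A] /=; [|exact: (ultraI uF)|exact: (ultraN uF)].
by apply: ultraS => // x; exact: AB.
Qed.

Lemma ultra_principal T (x : T) : ultra [set W : set T | W x].
Proof. by split => // A B; exact. Qed.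

(** The order is that of iterated quantifiers: the first term of the list is
    bound by the outermost one. *)
Fixpoint tpow T (F : set (set T)) k : set (set (seq T)) :=
  if k is k'.+1 then [set W | F (fun a => tpow F k' (fun s => W (a :: s)))]
  else [set W | W [::]].

Section Tpow.
Variables (T : Type) (F : set (set T)).
Hypothesis uF : ultra F.

Lemma tpowS k W : tpow F k.+1 W = F (fun a => tpow F k (fun s => W (a :: s))).
Proof. by []. Qed.

Lemma ultra_tpow k : ultra (tpow F k).
Proof.
elim: k => [|k IH] /=; first exact: ultra_principal.
apply: (ultra_bind (G := fun a W => tpow F k (fun s => W (a :: s)))) => // x.
exact: (ultra_preimage (cons x)).
Qed.

Lemma tpow_rcons k W :
  tpow F k.+1 W <-> tpow F k (fun s => F (fun a => W (rcons s a))).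
Proof.
elim: k W => [|k IH] W; first by split.
by rewrite tpowS [X in _ <-> X]tpowS; apply: ultra_congr => // a.
Qed.

Lemma tpow_size k (W : set (seq T)) :
  tpow F k W <-> tpow F k (fun s => size s = k /\ W s).
Proof.
elim: k W => [|k IH] W; first by split=> // -[].
rewrite tpowS [X in _ <-> X]tpowS.
apply: ultra_congr => // a; rewrite IH; apply: ultra_congr; first exact: ultra_tpow.
by move=> s /=; split=> -[]; [move=> -> ?|move=> [-> ?]].
Qed.

(** A quantifier over an unused term can be dropped. *)
Lemma tpow_mask (m : bitseq) (W : set (seq T)) :
  tpow F (size m) (fun s => W (mask m s)) <-> tpow F (count id m) W.
Proof.
elim: m W => [//|[] m IH] W /=.
  by apply: ultra_congr => // a; exact: (IH (fun s => W (a :: s))).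
by rewrite -IH; exact: (ultra_const uF).
Qed.

(** The filtered initial segment and the image of [i] are strictly sorted lists with the same
    members, hence equal. Choosing indices thus becomes masking, which suits induction on lists. *)
Lemma increasing_mask k r (i : 'I_r -> nat) (x0 : T) :
  (forall x y : 'I_r, (x < y)%N -> (i x < i y)%N) -> (forall x, (i x < k)%N) ->
  exists m : bitseq, [/\ size m = k, count id m = r & forall s, size s = k ->
    mask m s = [seq nth x0 s (i x) | x <- enum 'I_r]].
Proof.
move=> iP ik; pose m := [seq j \in codom i | j <- iota 0 k].
have E : [seq j <- iota 0 k | j \in codom i] = [seq i x | x <- enum 'I_r].
  apply: (irr_sorted_eq ltn_trans ltnn).
  - by apply: sorted_filter; [exact: ltn_trans|exact: iota_ltn_sorted].
  - rewrite sorted_map; have : sorted (relpre val ltn) (enum 'I_r).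
      by rewrite -sorted_map val_enum_ord iota_ltn_sorted.
    exact: sub_sorted.
  - move=> j; rewrite mem_filter mem_iota add0n -codomE.
    by case: (boolP (j \in codom i)) => //= /codomP[x ->]; rewrite ik.
exists m; split; first by rewrite size_map size_iota.
- by rewrite count_map -size_filter -[RHS](size_enum_ord r) -(size_map i) -E.
- move=> s sk; rewrite -[in LHS](mkseq_nth x0 s) sk /mkseq -map_mask -filter_mask E.
  by rewrite -map_comp.
Qed.

(** The right side does not mention [i]: this is why successive generic elements form an
    indiscernible sequence. *)
Lemma tpow_incr k r (i : 'I_r -> nat) (x0 : T) (W : set (seq T)) :
  (forall x y : 'I_r, (x < y)%N -> (i x < i y)%N) -> (forall x, (i x < k)%N) ->
  tpow F k (fun s => W [seq nth x0 s (i x) | x <- enum 'I_r]) <-> tpow F r W.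
Proof.
move=> iP ik; have [m [sm cm mP]] := increasing_mask x0 iP ik.
rewrite -[X in _ <-> tpow F X W]cm -tpow_mask sm tpow_size [X in _ <-> X]tpow_size.
apply: ultra_congr; first exact: ultra_tpow.
by move=> s; split=> -[sk]; rewrite mP.
Qed.

(** The variant for sequences whose later terms are bound further out; the mask is reversed along
    with the list. *)
Lemma tpow_incr_rev k r (i : 'I_r -> nat) (x0 : T) (W : set (seq T)) :
  (forall x y : 'I_r, (x < y)%N -> (i x < i y)%N) -> (forall x, (i x < k)%N) ->
  tpow F k (fun s => W [seq nth x0 (rev s) (i x) | x <- enum 'I_r]) <->
  tpow F r (fun s => W (rev s)).
Proof.
move=> iP ik; have [m [sm cm mP]] := increasing_mask x0 iP ik.
rewrite -[X in _ <-> tpow F X _]cm -count_rev -(tpow_mask (rev m)) size_rev sm.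
rewrite tpow_size [X in _ <-> X]tpow_size.
apply: ultra_congr; first exact: ultra_tpow.
move=> s; have E : size s = k -> rev (mask (rev m) s) = mask m (rev s).
  by move=> sk; rewrite -[s in LHS]revK -rev_mask ?revK // size_rev sk.
by split=> -[sk]; rewrite -mP ?size_rev // E.
Qed.

End Tpow.

(** * Ultrapowers *)

Section Ultrapower.
Variables (L : language) (U : structure L) (W : Type) (G : set (set W)).
Hypothesis uG : ultra G.

Definition germ (f : W -> U) : set (W -> U) := [set g | G (fun w => f w = g w)].

Lemma germP (f g : W -> U) : germ f = germ g <-> G (fun w => f w = g w).
Proof.
split=> [E|H].
  have : germ g g by apply: (ultra_true uG).
  by rewrite -E.
apply/seteqP; split => h; rewrite /germ /= => H'; apply: ultraS (ultraI uG H H') => //.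
  by move=> w [->].
by move=> w [->].
Qed.

(** A point is the whole set of its representatives, so that equality of points is genuine equality,
    as the semantics of [Equal] demands. *)
Definition upow_car : Type := {S : set (W -> U) | exists f, S = germ f}.

Definition cls (f : W -> U) : upow_car := exist _ (germ f) (ex_intro _ f erefl).

Definition rep (S : upow_car) : W -> U := sval (cid (svalP S)).

Lemma repK S : cls (rep S) = S.
Proof.
case: S => S pS; apply: eq_exist.
exact: esym (svalP (cid (svalP (exist _ S pS : upow_car)))).
Qed.

Lemma clsP (f g : W -> U) : cls f = cls g <-> G (fun w => f w = g w).
Proof.
rewrite -germP; split=> [E|E]; last exact: eq_exist.
by rewrite -[germ f]/(sval (cls f)) E.
Qed.

Lemma rep_cls (f : W -> U) : G (fun w => rep (cls f) w = f w).
Proof. by apply/clsP; rewrite repK. Qed.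

Lemma upow_inhabited : inhabited upow_car.
Proof. by have [u] := carrier_inhabited U; exact: (inhabits (cls (fun=> u))). Qed.

Definition upow : structure L := {|
  carrier := upow_car;
  carrier_inhabited := upow_inhabited;
  fun_interp := fun f v => cls (fun w => fun_interp (fun i => rep (v i) w));
  rel_interp := fun r v => G (fun w => rel_interp (fun i => rep (v i) w)) |}.

Lemma ultra_fin n (A : 'I_n -> set W) :
  (forall i, G (A i)) -> G (fun w => forall i, A i w).
Proof.
elim: n A => [|n IH] A GA; first by apply: (ultra_true uG) => w [].
apply: ultraS (ultraI uG (GA ord0) (IH (fun i => A (lift ord0 i)) _)) => //.
by move=> w [A0 A1] i; case: (unliftP ord0 i) => [j|] ->.
Qed.

Lemma eval_upow V (t : term L V) (v : V -> W -> U) :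
  eval (M := upow) (cls \o v) t = cls (fun w => eval (fun x => v x w) t).
Proof.
elim: t => [//|f ts IH] /=; apply/clsP.
have /= := ultra_fin (fun i => rep_cls (fun w => eval (fun x => v x w) (ts i))).
apply: ultraS => // w H; congr fun_interp; apply/funext => i.
by rewrite IH H.
Qed.

(** Los's theorem. In the quantifier case a counterexample is chosen in each coordinate, and the
    class of this choice is a counterexample in the ultrapower. *)
Lemma sat_upow V (phi : formula L V) (v : V -> W -> U) :
  sat (M := upow) phi (cls \o v) <-> G (fun w => sat phi (fun x => v x w)).
Proof.
elim: phi v => {V} [V|V s t|V r ts|V phi IH1 psi IH2|V phi IH] v.
- by rewrite (ultra_const uG).
- by rewrite /= !eval_upow clsP.
- apply: iff_trans
    (_ : G (fun w => rel_interp (fun i => rep (eval (M := upow) (cls \o v) (ts i)) w)) <-> _).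
    by split.
  have /= := ultra_fin (fun i => rep_cls (fun w => eval (fun x => v x w) (ts i))).
  move=> H; apply/ultra_iff => //; apply: ultraS H => // w H.
  have -> // : (fun i => rep (eval (M := upow) (cls \o v) (ts i)) w) =
          (fun i => eval (fun x => v x w) (ts i)).
  by apply/funext => i; rewrite eval_upow H.
- rewrite [X in G X](_ : _ = fun w => sat phi (fun x => v x w) -> sat psi (fun x => v x w)) //.
  by rewrite ultra_imp // -IH1 -IH2.
- have E (f : W -> U) w : (fun o => extend f v o w) = extend (f w) (fun x => v x w).
    by apply/funext => -[].
  have E' (f : W -> U) : cls \o extend f v = extend (cls f) (cls \o v).
    by apply/funext => -[].
  rewrite sat_All; split=> [H|H x].
  + apply: contrapT => /(ultraN uG) N.
    have /choice[f fP] : forall w, exists u, ~ sat (All phi) (fun x => v x w) ->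
        ~ sat phi (extend u (fun x => v x w)).
      move=> w; have [u] := carrier_inhabited U.
      have [|Nw] :=
        pselect (exists u, ~ sat phi (extend u (fun x => v x w))).
        by move=> [u' ?]; exists u'.
      exists u => -[]; rewrite sat_All => x; apply: contrapT => n.
      by apply: Nw; exists x.
    have := H (cls f); rewrite -E' IH => /(ultraI uG N)/(ultra_ex uG)[w [/fP]].
    by rewrite E.
  + rewrite -[x]repK -E' IH; apply: ultraS H => // w; rewrite sat_All E; exact.
Qed.

Definition diag (u : U) : upow := cls (fun=> u).

Lemma diag_elementary : elementary_embedding diag.
Proof.
move=> phi; rewrite (sat_upow phi (fun u => fun=> u)).
by rewrite (ultra_const uG).
Qed.

End Ultrapower.

(** * Small sets *)

Lemma injective_card_le (X Y : Type) (f : X -> Y) :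
  injective f -> [set: X] #<= [set: Y].
Proof.
move=> fI; apply: (@card_le_trans _ _ _ (range f)); last exact: card_leT.
have : range f #= [set: X] by apply: inj_card_eq => x y _ _ /fI.
by rewrite card_eq_le => /andP[].
Qed.

Lemma card_le_injective (X Y : Type) :
  [set: X] #<= [set: Y] -> exists f : X -> Y, injective f.
Proof.
move=> /card_leP[f]; pose u (x : X) : [set: X] := exist _ x (mem_setT x).
exists (fun x => val (f (u x))) => x y /val_inj/inj.
by rewrite !inE => /(_ I I)/(congr1 val).
Qed.

(** Zorn's lemma on graphs of partial injections: a maximal one is total on one side, for otherwise
    a pair of unmatched points could be added. *)
Lemma card_le_total (X Y : Type) :
  [set: X] #<= [set: Y] \/ [set: Y] #<= [set: X].
Proof.
pose P (R : set (X * Y)) :=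
  forall a b, R a -> R b -> a.1 = b.1 <-> a.2 = b.2.
have [|R [PR Rmax]] := @Zorn_bigcup _ P.
  move=> F FP Ftot a b [R FR Ra] [S FS Sb].
  by have [/(_ _ Ra)|/(_ _ Sb)] := Ftot _ _ FR FS; [move: Sb|move: Ra];
    move=> ? ?; [apply: (FP _ FS)|apply: (FP _ FR)].
have [/choice[f fP]|nX] := pselect (forall x, exists y, R (x, y)).
  left; apply: (injective_card_le (f := f)) => x x' E.
  exact: (iffRL (PR _ _ (fP x) (fP x')) E).
have [/choice[f fP]|nY] := pselect (forall y, exists x, R (x, y)).
  right; apply: (injective_card_le (f := f)) => y y' E.
  exact: (iffLR (PR _ _ (fP y) (fP y')) E).
have [x xP] : exists x, forall y, ~ R (x, y).
  apply: contrapT => N; apply: nX => x; apply: contrapT => N'.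
  by apply: N; exists x => y Rxy; apply: N'; exists y.
have [y yP] : exists y, forall x, ~ R (x, y).
  apply: contrapT => N; apply: nY => y; apply: contrapT => N'.
  by apply: N; exists y => x' Rxy; apply: N'; exists x'.
exfalso; apply: (Rmax (R `|` [set (x, y)])).
  split; first by move=> a; left.
  by move=> /(_ (x, y))/= H; apply: (xP y); apply: H; right.
move=> [a1 a2] [b1 b2] [Ra|[-> ->]] [Rb|[-> ->]] //=.
- exact: (PR _ _ Ra Rb).
- by split=> E; [case: (xP a2); rewrite -E|case: (yP a1); rewrite -E].
- by split=> E; [case: (xP b2); rewrite E|case: (yP b1); rewrite E].
Qed.

Lemma eq_set1 (T : Type) (x y : T) : [set x] = [set y] :> set T -> x = y.
Proof. by move=> /seteqP[/(_ x erefl)]. Qed.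

Section Small.
Variable K : Type.
Hypotheses (Kinf : small K [set: nat]) (Kpow : strong_limit K).

Definition smallT (X : Type) := small K [set: X].

Lemma small_le (X Y : Type) (A : set X) (B : set Y) :
  A #<= B -> small K B -> small K A.
Proof.
move=> AB [BK nKB]; split; first exact: card_le_trans BK.
by move=> KA; apply: nKB; exact: card_le_trans AB.
Qed.

Lemma small_inj (X Y : Type) (f : X -> Y) : injective f -> smallT Y -> smallT X.
Proof. by move=> /injective_card_le; exact: small_le. Qed.

Lemma small_image (X Y : Type) (f : X -> Y) (A : set X) :
  small K A -> small K (f @` A).
Proof. exact/small_le/card_image_le. Qed.

Lemma small_sub (X : Type) (A B : set X) : A `<=` B -> small K B -> small K A.
Proof. by move=> /subset_card_le; exact: small_le. Qed.

Lemma small_set_type (X : Type) (A : set X) : smallT A <-> small K A.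
Proof.
split=> [|sA].
  by move=> /(small_image val); apply: small_sub => x /mem_set Ax; exists (exist _ x Ax).
apply: small_le sA.
have : range (val : A -> X) #= [set: A].
  by apply: inj_card_eq => x y _ _ /val_inj.
rewrite card_eq_le => /andP[_ /card_le_trans]; apply.
by apply: subset_card_le => _ [x _ <-]; exact: set_valP.
Qed.

(** Cardinal arithmetic is replaced by power sets, which stay small by [Kpow]. The double power set
    of the larger summand receives both: one as {{f x}}, the other as {{y}, {}}. *)
Lemma small_add (X Y : Type) : smallT X -> smallT Y -> smallT (X + Y).
Proof.
suff H X' Y' : [set: X'] #<= [set: Y'] -> smallT Y' -> smallT (X' + Y').
  move=> sX sY; have [XY|YX] := card_le_total X Y; first exact: H.
  pose f (s : X + Y) : Y + X := match s with inl x => inr x | inr y => inl y end.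
  apply: (small_inj (f := f)) (H _ _ YX sX).
  by move=> [x|y] [x'|y'] // [->].
move=> XY sY.
have [f fI] : exists f : X' -> Y', injective f := card_le_injective XY.
have sYY := Kpow (Kpow sY).
apply: (small_inj (f := fun s : X' + Y' => match s with
  | inl x => [set [set f x]] | inr y => [set [set y]; set0] end)) sYY.
have N (y z : Y') : [set [set y]] <> [set [set z]; set0].
  move=> E; have : [set [set y]] set0 by rewrite E; right.
  by move=> /= E'; have : [set y] y := erefl; rewrite -E'.
move=> [x|y] [x'|y'].
- move=> E; congr inl; apply: fI; exact: eq_set1 (eq_set1 E).
- by move=> /N.
- by move=> /esym/N.
- move=> E; congr inr.
  have : [set [set y']; set0] [set y] by rewrite -E; left.
  case=> [/= E'|/= E']; first exact: eq_set1 E'.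
  by have : [set y] y := erefl; rewrite E'.
Qed.

Lemma small_prod (X Y : Type) : smallT X -> smallT Y -> smallT (X * Y).
Proof.
move=> sX sY; have sXY := Kpow (small_add sX sY).
pose f (a : X * Y) : set (X + Y) := [set inl a.1; inr a.2].
apply: (small_inj (f := f)) sXY => -[x y] [x' y'] E.
have : f (x', y') (inl x) by rewrite -E; left.
have : f (x', y') (inr y) by rewrite -E; right.
by move=> [//|[->]] [[->]|].
Qed.

Lemma small_seq (X : Type) : smallT X -> smallT (seq X).
Proof.
move=> sX; pose f (s : seq X) : set (nat * X) := [set a | onth s a.1 = Some a.2].
apply: (small_inj (f := f)) (Kpow (small_prod Kinf sX)) => s t E.
have H i x : onth s i = Some x <-> onth t i = Some x.
  by have := congr1 (fun F : set _ => F (i, x)) E; rewrite /f /= => ->.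
apply: eq_from_onth => i; case Es: (onth s i) => [x|].
  by rewrite (iffLR (H i x) Es).
by case Et: (onth t i) => [x|//]; rewrite -Es (iffRL (H i x) Et).
Qed.

Lemma small_tree (X : Type) : smallT X -> smallT (GenTree.tree X).
Proof.
move=> sX; apply: (small_inj (f := @GenTree.encode X)).
  exact: pcan_inj (@GenTree.codeK X).
exact/small_seq/small_add.
Qed.

Lemma eq_map_enum n (T : Type) (f g : 'I_n -> T) :
  [seq f i | i <- enum 'I_n] = [seq g i | i <- enum 'I_n] -> f = g.
Proof.
by move=> /eq_in_map E; apply/funext => i; apply: E; rewrite mem_enum.
Qed.

(** * Counting terms and formulas by coding them as trees *)

Section Term.
Variables (L : language) (cF : fun_sym L -> nat) (cFI : injective cF).

Fixpoint code_term V T (f : V -> T) (t : term L V) : GenTree.tree T :=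
  match t with
  | Var x => GenTree.Leaf (f x)
  | App g ts => GenTree.Node (cF g) [seq code_term f (ts i) | i <- enum 'I_(fun_ar g)]
  end.

Lemma code_term_inj V T (f : V -> T) : injective f -> injective (code_term f).
Proof.
move=> fI; elim=> [x|g ts IH] [y|h us] //=; first by move=> [/fI ->].
move=> [/cFI E]; subst h => /eq_map_enum E; congr App.
by apply/funext => i; apply: IH; exact: (congr1 (fun F => F i) E).
Qed.

Lemma small_term V : smallT V -> smallT (term L V).
Proof.
move=> /small_tree; apply: small_inj; exact: (code_term_inj (f := id)).
Qed.

Variables (cR : rel_sym L -> nat) (cRI : injective cR).

(** De Bruijn indices: a bound variable is a number that grows with each binder crossed, a free one
    keeps its name in [T]. *)
Definition shift V T (f : V -> nat + T) (o : option V) : nat + T :=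
  match o with
  | None => inl 0
  | Some v => match f v with inl n => inl n.+1 | inr x => inr x end
  end.

Lemma shift_inj V T (f : V -> nat + T) : injective f -> injective (shift f).
Proof.
move=> fI [v|] [w|] //=; last by case: (f w).
  move=> E; congr Some; apply: fI.
  by move: E; case: (f v) => a; case: (f w) => b // [->].
by case: (f v).
Qed.

Fixpoint code_formula V T (f : V -> nat + T) (phi : formula L V) :
    GenTree.tree (nat + T) :=
  match phi with
  | Bot => GenTree.Node 0 [::]
  | Equal s t => GenTree.Node 1 [:: code_term f s; code_term f t]
  | Atom r ts => GenTree.Node 2 (GenTree.Node (cR r) [::] ::
      [seq code_term f (ts i) | i <- enum 'I_(rel_ar r)])
  | Imp phi psi => GenTree.Node 3 [:: code_formula f phi; code_formula f psi]
  | All phi => GenTree.Node 4 [:: code_formula (shift f) phi]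
  end.

Lemma code_formula_inj V T (f : V -> nat + T) :
  injective f -> injective (code_formula f).
Proof.
move=> fI phi; elim: phi f fI => {V}
  [V|V s t|V r ts|V phi IH1 psi IH2|V phi IH] f fI [|s' t'|r' ts'|phi' psi'|phi'] //=.
- by move=> [/(code_term_inj fI) -> /(code_term_inj fI) ->].
- move=> [/cRI E]; subst r' => /eq_map_enum E; congr Atom.
  apply/funext => i; apply: (code_term_inj fI).
  exact: (congr1 (fun F => F i) E).
- by move=> [/(IH1 _ fI) -> /(IH2 _ fI) ->].
- by move=> [/(IH _ (shift_inj fI)) ->].
Qed.

End Term.

Variable L : language.
Hypothesis hL : countable_language L.

Lemma countable_codes : exists (cF : fun_sym L -> nat) (cR : rel_sym L -> nat),
  injective cF /\ injective cR.
Proof.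
have [/countable_injP[cF cFI] /countable_injP[cR cRI]] := hL.
by exists cF, cR; split=> x y; [apply: cFI|apply: cRI]; rewrite inE.
Qed.

Lemma small_formula V : smallT V -> smallT (formula L V).
Proof.
move=> sV; have [cF [cR [cFI cRI]]] := countable_codes.
apply: (small_inj (f := code_formula cF cR (@inr nat V))).
  by apply: code_formula_inj => // x y [].
exact/small_tree/small_add.
Qed.

(** Free variables are numbered too and [void] is left for names, so the codes are trees over a
    countable type. Later this numbers the Skolem functions. *)
Lemma countable_formula k : exists c : formula L (option 'I_k) -> nat, injective c.
Proof.
have [cF [cR [cFI cRI]]] := countable_codes.
pose f (o : option 'I_k) : nat + void := shift (fun i => inl (val i)) o.
have fI : injective f by apply: shift_inj => i j [/val_inj].
exists (fun phi => pickle (code_formula cF cR f phi)) => phi psi E.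
apply: (code_formula_inj cFI cRI fI); exact: (pcan_inj pickleK E).
Qed.
End Small.

(** * Types in a monster model *)

(** The Tarski-Vaught test. Closure under a function symbol comes from the formula x = f(v),
    non-emptiness from a formula that always holds. *)
Lemma tarski_vaught L (U : structure L) (M : set U) :
  (forall k (phi : formula L (option 'I_k)) (v : 'I_k -> U),
    (forall i, M (v i)) -> (exists x, sat phi (extend x v)) ->
    exists2 x, M x & sat phi (extend x v)) ->
  elementary_substructure M.
Proof.
move=> MP.
have M0 : inhabited M.
  have [u] := carrier_inhabited U.
  have [||x /mem_set Mx _] := MP 0 (Neg Bot) (fun=> u); [by case|by exists u|].
  by constructor; exact: (exist _ x Mx).
have Mf f (v : 'I_(fun_ar f) -> M) : fun_interp (fun i => val (v i)) \in M.
  have [||x Mx E] :=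
    MP _ (Equal (Var None) (App f (fun i => Var (Some i)))) (fun i => val (v i)).
  - by move=> i; exact: set_valP.
  - by exists (fun_interp (fun i => val (v i))).
  - by apply/mem_set; rewrite -[fun_interp _]E.
pose N := @Structure L M M0 (fun f v => exist (fun x => x \in M) _ (Mf f v))
  (fun r v => rel_interp (fun i => val (v i))).
have eN V (t : term L V) (v : V -> N) : val (eval v t) = eval (M := U) (val \o v) t.
  by elim: t => //= f ts IH; congr fun_interp; apply/funext => i; exact: IH.
have sN V (phi : formula L V) (v : V -> N) : sat phi v <-> sat (M := U) phi (val \o v).
  elim: phi v => {V} [V|V s t|V r ts|V phi IH1 psi IH2|V phi IH] v //=.
  - by rewrite -!eN; split=> [->|/val_inj].
  - have -> : (fun i => eval (val \o v) (ts i)) = (fun i => val (eval v (ts i))).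
      by apply/funext => i; rewrite eN.
    by [].
  - by rewrite IH1 IH2.
  - have E x : val \o extend x v = extend (val x) (val \o v).
      by apply/funext => -[].
    split=> H x; last first.
      by rewrite IH E; exact: H.
    apply: contrapT => nx.
    (* The test allows finitely many parameters while [V] is arbitrary, so [phi] is rewritten over
       its finite support before a counterexample is sought in [M]. *)
    have [S [fS SP]] := finite_support phi.
    have fS' : finite_set (Some @^-1` S).
      by apply: finite_preimage => // y z _ _ [].
    have [k [g gE]] := finite_range fS'.
    have [|phi0 E0] := SP _ (omap g).
      move=> [y Sy|_]; last by exists None.
      have : (Some @^-1` S) y by [].
      by rewrite gE => -[i _ <-]; exists (Some i).
    have [||y My] := MP _ (Neg phi0) (fun i => val (v (g i))).
    + by move=> i; exact: set_valP.
    + by exists x => nx'; apply: nx; rewrite E0 sat_rename extend_omap.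
    + apply; have := H (exist _ y (mem_set My)).
      by rewrite IH E E0 sat_rename extend_omap.
exists N, val; split; first by move=> phi; exact: sN.
apply/seteqP; split=> [_ [x _ <-]|x /mem_set Mx]; first exact: set_valP.
by exists (exist _ x Mx).
Qed.

Lemma sat_automorphism L (U : structure L) (s : U -> U) V (phi : formula L V)
    (v : V -> U) : automorphism s -> sat phi (s \o v) <-> sat phi v.
Proof.
move=> [[s' sK s'K] sf sr].
have E W (t : term L W) (w : W -> U) : eval (s \o w) t = s (eval w t).
  by elim: t => //= f ts IH; rewrite sf; congr fun_interp; apply/funext => i; exact: IH.
elim: phi v => {V} [V|V t t'|V r ts|V phi IH1 psi IH2|V phi IH] v //=.
- by rewrite !E; split=> [/(can_inj sK)|->].
- have -> : (fun i => eval (s \o v) (ts i)) = (fun i => s (eval v (ts i))).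
    by apply/funext => i; rewrite E.
  by rewrite -sr.
- by rewrite IH1 IH2.
- have Ex x : s \o extend x v = extend (s x) (s \o v) by apply/funext => -[].
  by split=> H x; [rewrite -IH Ex; exact: H|rewrite -[x]s'K -Ex IH; exact: H].
Qed.

(** The symbol of a formula is meant to pick a witness for its variable [None], given values of the
    other variables. *)
Definition skolem_language (L : language) : language := {|
  fun_sym := {k & formula L (option 'I_k)};
  fun_ar := fun s => tag s;
  rel_sym := void;
  rel_ar := of_void nat |}.

Section Monster.
Variables (K : Type) (L : language) (U : structure L).
Hypotheses (hL : countable_language L) (hU : monster K U).

Let Kinf := monster_uncountable hU.
Let Kpow := monster_strong_limit hU.

Lemma small_finite (X : Type) (S : set X) : finite_set S -> small K S.
Proof. by move=> /finite_set_countable; move/small_le; apply. Qed.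

Lemma small_setU (X : Type) (A B : set X) : small K A -> small K B -> small K (A `|` B).
Proof.
move=> /small_set_type sA /small_set_type sB.
have /(small_image (fun s : A + B => match s with inl x => val x | inr x => val x end)) :=
  small_add Kpow sA sB.
apply: small_sub => x [] /mem_set Mx.
  by exists (inl (exist _ x Mx)).
by exists (inr (exist _ x Mx)).
Qed.

(** The hull consists of the values of terms in a Skolem language, so that
    counting it reduces to counting terms. *)
Lemma small_hull (B : Type) (f : B -> U) : smallT K B ->
  exists M : set U, range f `<=` M /\ small_model K M.
Proof.
move=> sB; have [u0] := carrier_inhabited U.
pose skolem (s : {k & formula L (option 'I_k)}) (v : 'I_(tag s) -> U) : U :=
  if pselect (exists x, sat (tagged s) (extend x v)) is left h then sval (cid h) else u0.
have UI : inhabited U by [].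
pose US : structure (skolem_language L) :=
  @Structure (skolem_language L) U UI skolem (fun r _ => False).
exists (range (eval (M := US) f)); split.
  by move=> _ [b _ <-]; exists (Var b).
split.
  apply: small_image.
  pose c k := sval (cid (countable_formula hL k)).
  have cI k : injective (c k) := svalP (cid (countable_formula hL k)).
  pose cF (s : fun_sym (skolem_language L)) := pickle (tag s, c _ (tagged s)).
  apply: (small_term Kinf Kpow (cF := cF)) => // -[k phi] [k' phi'] /(pcan_inj pickleK).
  by case=> E; subst k' => /cI ->.
apply: tarski_vaught => k phi v vP ex.
have /choice[t tP'] : forall i, exists t, eval (M := US) f t = v i.
  by move=> i; have [t _] := vP i; exists t.
pose s : fun_sym (skolem_language L) := existT _ k phi.
exists (skolem s v).
  exists (@App (skolem_language L) _ s t) => //=.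
  by congr skolem; apply/funext => i; rewrite tP'.
by rewrite /skolem; case: pselect => // h; exact: svalP (cid h).
Qed.

(** The types over [M] are sets of formulas from a small set, hence few by the strong limit
    hypothesis; a realization of each goes into the generators of a hull. *)
Lemma small_model_realizing (M : set U) : small_model K M ->
  exists N : set U, [/\ small_model K N, M `<=` N &
    forall k (w : 'I_k -> U), exists w' : 'I_k -> U,
      (forall i, N (w' i)) /\ same_type M w' w].
Proof.
move=> [sM _]; have [u0] := carrier_inhabited U.
pose tp (w : nat -> U) : set (formula L (nat + M)) :=
  [set phi | sat phi (assign w (fun a : M => val a))].
have /choice[R RP] : forall q, exists w, (exists w', tp w' = q) -> tp w = q.
  move=> q; have [[w wq]|nq] := pselect (exists w', tp w' = q); first by exists w.
  by exists (fun=> u0).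
have sM' : smallT K M by apply/small_set_type.
have sB : smallT K (M + set (formula L (nat + M)) * nat).
  apply: small_add => //; apply: small_prod => //; apply: Kpow.
  by apply: small_formula => //; exact: small_add.
pose f (s : M + set (formula L (nat + M)) * nat) : U :=
  match s with inl a => val a | inr a => R a.1 a.2 end.
have [N [fN sN]] := small_hull f sB; exists N; split => //.
  by move=> x /mem_set Mx; apply: fN; exists (inl (exist _ x Mx)).
(* Padding a [k]-tuple with [u0] to a sequence over [nat] lets one family of types serve every
   [k]. *)
move=> k w; pose w0 i := if insub i is Some j then w j else u0.
exists (fun i => R (tp w0) i); split.
  by move=> i; apply: fN; exists (inr (tp w0, val i)).
have E : tp (R (tp w0)) = tp w0 by apply: RP; exists w0.
move=> phi; pose g (s : 'I_k + M) : nat + M :=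
  match s with inl i => inl (val i) | inr a => inr a end.
have /= := congr1 (fun F : set _ => F (rename g phi)) E.
rewrite /tp /= !sat_rename !(assign_comp val id) /=.
have -> : w0 \o val = w by apply/funext => i; rewrite /w0 /= valK.
by move=> ->.
Qed.

(** Homogeneity is applied to the map that fixes [M] and sends [v] to [w]; [g] names each element of
    its domain by an entry of [v] or a parameter. *)
Lemma same_type_automorphism (M : set U) k (v w : 'I_k -> U) : small K M ->
  same_type M v w ->
  exists s, [/\ automorphism s, forall x, M x -> s x = x & forall i, s (v i) = w i].
Proof.
move=> sM vw; pose A := M `|` range v.
have sA : small K A.
  by apply: small_setU => //; apply/small_image/small_finite; exact: finite_finset.
have /choice[g gP] : forall a : A, exists t : 'I_k + M,
    assign v (fun a : M => val a) t = val a.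
  move=> a; have [/mem_set Ma|[i _ E]] := set_valP a; last by exists (inl i).
  by exists (inr (exist (fun x => x \in M) _ Ma)).
have [|s [sA' sP]] := monster_homogeneous hU
    (f := fun a : A => assign w (fun a : M => val a) (g a)) sA.
  move=> phi; have := vw (rename g phi); rewrite !sat_rename.
  by have -> : assign v (fun a : M => val a) \o g = (fun a => val a) by apply/funext.
(* The value does not depend on the name: two names that agree at [v] agree at [w], equality being
   part of the type. *)
have H (a : A) t : assign v (fun a : M => val a) t = val a ->
    s (val a) = assign w (fun a : M => val a) t.
  move=> E; rewrite sP; have /= := vw (Equal (Var (g a)) (Var t)).
  by rewrite gP E => -[-> //].
exists s; split=> // [x Mx|i].
  have Ax : x \in A by apply/mem_set; left.
  exact: (H (exist _ x Ax) (inr (exist (fun x => x \in M) x (mem_set Mx)))).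
have Ax : v i \in A by apply/mem_set; right; exists i.
exact: (H (exist _ (v i) Ax) (inl i)).
Qed.

(** The formulas true [D]-almost everywhere form a complete type over [A], which saturation
    realizes. *)
Lemma realize_ultra (A : set U) m (D : set (set ('I_m -> U))) :
  small K A -> ultra D -> exists c : 'I_m -> U, forall th : formula L ('I_m + A),
    D (fun y => sat th (assign y (fun a : A => val a))) <->
    sat th (assign c (fun a : A => val a)).
Proof.
move=> sA uD; pose q : set (formula L ('I_m + A)) :=
  [set th | D (fun y => sat th (assign y (fun a : A => val a)))].
have [|c cP] := monster_saturated hU (p := q) sA.
  split=> [F Fq /finite_range[k [w wE]]|th]; last first.
    have [?|/(ultraN uD) ?] := pselect (D (fun y => sat th (assign y (fun a : A => val a)))).
      by left.
    by right.
  have /(ultra_ex uD)[v vP] : D (fun y => forall i, sat (w i) (assign y (fun a : A => val a))).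
    by apply: ultra_fin => // i; apply: Fq; rewrite wE; exists i.
  by exists v => phi; rewrite wE => -[i _ <-].
exists c => th; split=> [|cth]; first exact: cP.
apply: contrapT => /(ultraN uD) N.
exact: (cP (Neg th) N cth).
Qed.

(** * Deduction inside a global type *)

Section Type_p.
Variables (n : nat) (p : set (formula L ('I_n + U))).
Hypothesis hp : global_type p.

Lemma type_sat3 a b c : p a -> p b -> p c ->
  exists v : 'I_n -> U, [/\ sat a (assign v id), sat b (assign v id) & sat c (assign v id)].
Proof.
move=> pa pb pc; have [] := hp.1 [set a; b; c].
- by move=> _ [[->|->]|->].
- by rewrite !finite_setU; do !split; exact: finite_set1.
- by move=> v vP; exists v; split; apply: vP; [left; left|left; right|right].
Qed.

Lemma typeN a : p (Neg a) <-> ~ p a.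
Proof.
split=> [pna pa|npa]; last by case: (hp.2 a).
by have [v []] := type_sat3 pna pa pa.
Qed.

Lemma type_imp a b c : (forall v : 'I_n -> U, sat a (assign v id) ->
  sat b (assign v id) -> sat c (assign v id)) -> p a -> p b -> p c.
Proof.
move=> H pa pb; apply: contrapT => /typeN pc.
have [v [va vb]] := type_sat3 pa pb pc.
by rewrite satN; apply; exact: H.
Qed.

Lemma type_And a b : p a -> p b -> p (And a b).
Proof. by apply: type_imp => v ? ?; rewrite sat_And. Qed.

Lemma type_Iff a b : p (Iff a b) -> p a <-> p b.
Proof.
move=> pi; split=> pa; move: pi pa; apply: type_imp => v;
  by rewrite /Iff sat_And /= => -[]; auto.
Qed.

End Type_p.
End Monster.

(** * Two mutually indiscernible sequences *)

Lemma lift_set (T X : Type) (A : set T) (w : X -> T) :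
  (forall i, A (w i)) -> exists w' : X -> A, w = val \o w'.
Proof.
move=> wA; exists (fun i => exist (fun x => x \in A) (w i) (mem_set (wA i))).
by [].
Qed.

Lemma indiscernible_sat L (N : structure L) (A : set N) d (J : orderType d) m n
    (I : J -> 'I_m -> N) (a : 'I_n -> N) (phi : formula L ('I_n + 'I_m)) (j j' : J) :
  indiscernible A I -> (forall i, A (a i)) ->
  sat phi (assign a (I j)) <-> sat phi (assign a (I j')).
Proof.
move=> AI /lift_set[a' ->].
pose g (s : 'I_n + 'I_m) : ('I_1 * 'I_m) + A :=
  match s with inl x => inr (a' x) | inr l => inl (ord0, l) end.
have E (j0 : J) : assign (fun xl : 'I_1 * 'I_m => I j0 xl.2) (fun x : A => val x) \o g =
    assign (val \o a') (I j0) by apply/funext => -[].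
have incr (f : 'I_1 -> J) (x y : 'I_1) : (x < y)%N -> (f x < f y)%O.
  by rewrite !ord1.
have := AI 1 (fun=> j) (fun=> j') (incr _) (incr _) (rename g phi).
by rewrite !sat_rename !E.
Qed.

Lemma indiscernible_sub L (N : structure L) (A B : set N) d (J : orderType d) m
    (I : J -> 'I_m -> N) :
  A `<=` B -> indiscernible B I -> indiscernible A I.
Proof.
move=> AB BI k i j iP jP phi.
have [g gE] : exists g : A -> B, (fun a : A => val a) = val \o g.
  by apply: lift_set => a; apply: AB; exact: set_valP.
have := BI k i j iP jP
  (rename (fun s => match s with inl x => inl x | inr y => inr (g y) end) phi).
by rewrite !sat_rename !(assign_comp id) gE.
Qed.

(** Los's theorem turns indiscernibility into an invariance of [G]. Parameters are classes of
    functions that factor through [t], and formulas are absorbed into arbitrary relations [R]. *)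
Lemma indiscernible_upow L (U : structure L) (W T : Type) (G : set (set W)) m
    (s : W -> nat -> 'I_m -> U) (t : W -> T) (A : set (upow U G)) :
  ultra G ->
  (forall x, A x -> exists h : T -> U, x = cls G (h \o t)) ->
  (forall r (i j : 'I_r -> nat) (R : T -> ('I_r -> 'I_m -> U) -> Prop),
    (forall x y : 'I_r, (x < y)%N -> (i x < i y)%N) ->
    (forall x y : 'I_r, (x < y)%N -> (j x < j y)%N) ->
    G (fun w => R (t w) (s w \o i)) <-> G (fun w => R (t w) (s w \o j))) ->
  indiscernible (N := upow U G) A (fun j l => cls G (fun w => s w j l)).
Proof.
move=> uG AP sP k i j iP jP phi.
have /choice[h hP] : forall a : A, exists h : T -> U, val a = cls G (h \o t).
  by move=> a; apply: AP; exact: set_valP.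
have E (i' : 'I_k -> nat) :
    assign (fun xl : 'I_k * 'I_m => cls G (fun w => s w (i' xl.1) xl.2)) (fun a : A => val a) =
    cls G \o assign (fun xl w => s w (i' xl.1) xl.2) (fun a w => h a (t w)).
  by apply/funext => -[//|a] /=; rewrite hP.
rewrite !E !sat_upow //.
pose R b (f : 'I_k -> 'I_m -> U) :=
  sat phi (assign (fun xl => f xl.1 xl.2) (fun a => h a b)).
have R' (i' : 'I_k -> nat) : (fun w => sat phi (fun x =>
    assign (fun xl w => s w (i' xl.1) xl.2) (fun a w => h a (t w)) x w)) =
    (fun w => R (t w) (s w \o i')).
  by apply/funext => w; congr sat; apply/funext => -[].
by rewrite !R'; exact: sP.
Qed.

Lemma nth_map_enum r (T : Type) (x0 : T) (f : 'I_r -> T) :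
  (fun x : 'I_r => nth x0 [seq f x | x <- enum 'I_r] x) = f.
Proof.
apply/funext => x; rewrite (nth_map x) ?size_enum_ord //.
by rewrite nth_ord_enum.
Qed.

(** * Ultrafilters from the failure of definability and of finite satisfiability *)

Section Core.
Variables (K : Type) (L : language) (U : structure L).
Hypotheses (hL : countable_language L) (hU : monster K U).
Variables (n : nat) (p : set (formula L ('I_n + U))).
Hypothesis hp : global_type p.
Variable M : set U.
Hypothesis sM : small K M.
Hypothesis pM : invariant_over M p.

Let inv m (phi : formula L ('I_n + 'I_m)) b b' :
  same_type M b b' -> p (plug phi b) <-> p (plug phi b').
Proof. by move=> /(pM phi); exact: type_Iff. Qed.

(** At the type of [b] over [M], membership of [phi] in [p] is not locally constant. Were it locally
    constant at every point for every formula, compactness would yield a definition over [M]. *)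
Lemma not_definable : ~ definable_over M p ->
  exists m (phi : formula L ('I_n + 'I_m)) (b : 'I_m -> U), p (plug phi b) /\
    forall th : formula L ('I_m + M), sat th (assign b (fun a : M => val a)) ->
      exists b', sat th (assign b' (fun a : M => val a)) /\ ~ p (plug phi b').
Proof.
apply: contra_notP => N m phi; pose v := fun a : M => val a.
have iso (phi' : formula L ('I_n + 'I_m)) b : p (plug phi' b) ->
    exists th : formula L ('I_m + M), sat th (assign b v) /\
      forall b', sat th (assign b' v) -> p (plug phi' b').
  move=> pb; apply: contrapT => N'; apply: N; exists m, phi', b; split=> // th thb.
  apply: contrapT => N''; apply: N'; exists th; split=> // b' thb'.
  by apply: contrapT => npb'; apply: N''; exists b'.
(* On [th0] the formula is always outside [p], on [th1] always inside; members of [F] contain all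
   that the two leave uncovered. *)
pose F (W : set ('I_m -> U)) := exists th0 th1 : formula L ('I_m + M),
  [/\ forall b, sat th0 (assign b v) -> ~ p (plug phi b),
      forall b, sat th1 (assign b v) -> p (plug phi b) &
      forall b, ~ sat th0 (assign b v) -> ~ sat th1 (assign b v) -> W b].
(* If a member of [F] is empty, [th0] and [th1] cover everything and [th1] is a definition. *)
have [Fn|] := pselect (forall W, F W -> exists b, W b); last first.
  move=> /existsNP[W] /not_implyP[[th0 [th1 [H0 H1 H]]]] W0; exists th1 => b.
  split=> [pb|/H1//]; apply: contrapT => nb; apply: W0; exists b; apply: H => //.
  by move=> /H0.
have [||D [uD FD]] := @ultra_extend _ F _ _ Fn.
- by exists Bot, Bot; split.
- move=> W W' [th0 [th1 [H0 H1 H]]] [th0' [th1' [H0' H1' H']]].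
  exists (Or th0 th0'), (Or th1 th1').
  split=> b; rewrite ?sat_Or; [by case; auto|by case; auto|].
  by move=> n0 n1; split; [apply: H|apply: H']; tauto.
(* Otherwise [c] lies in no set of either kind, although [iso] places it in one, applied to [phi] or
   to its negation. *)
have [c cP] := realize_ultra hU sM uD.
have no (th : formula L ('I_m + M)) : sat th (assign c v) -> ~ F (fun b => ~ sat th (assign b v)).
  by move=> /cP Dth /FD /(ultraN uD).
have [pc|npc] := pselect (p (plug phi c)).
  have [th [thc H]] := iso phi c pc; case: (no th thc).
  by exists Bot, th; split.
have /(iso (Neg phi))[th [thc H]] : p (Neg (plug phi c)) by apply/typeN.
case: (no th thc); exists th, Bot; split=> // b /H.
by move=> /(typeN hp).
Qed.

Variable N0 : set U.
Hypothesis sN0 : small K N0.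
Hypothesis MN0 : M `<=` N0.
Hypothesis N0P : forall k (w : 'I_k -> U), exists w' : 'I_k -> U,
  (forall i, N0 (w' i)) /\ same_type M w' w.

(** A tuple supplied by the hypothesis may be replaced by one of [N0] with the same type over [M];
    invariance keeps its instance of [phi] out of [p]. So the sets in [F] are non-empty. *)
Lemma not_definable_ultra m (phi : formula L ('I_n + 'I_m)) (b : 'I_m -> U) :
  (forall th : formula L ('I_m + M), sat th (assign b (fun a : M => val a)) ->
      exists b', sat th (assign b' (fun a : M => val a)) /\ ~ p (plug phi b')) ->
  exists Q, [/\ ultra Q,
    forall th : formula L ('I_m + M), sat th (assign b (fun a : M => val a)) ->
      Q (fun b' => sat th (assign b' (fun a : M => val a))),
    Q (fun b' => ~ p (plug phi b')) & Q (fun b' => forall i, N0 (b' i))].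
Proof.
set v := (fun a : M => val a) => H.
pose F (W : set ('I_m -> U)) := exists2 th : formula L ('I_m + M),
  sat th (assign b v) & forall b', sat th (assign b' v) -> ~ p (plug phi b') ->
    (forall i, N0 (b' i)) -> W b'.
have [|||Q [uQ FQ]] := @ultra_extend _ F.
- by exists (Neg Bot).
- move=> W W' [th thb thW] [th' thb' thW']; exists (And th th'); first by rewrite sat_And.
  by move=> b'; rewrite sat_And => -[? ?] ? ?; split; [apply: thW|apply: thW'].
- move=> W [th thb thW]; have [b' [thb' npb']] := H th thb.
  have [w [wN wb']] := N0P b'; exists w; apply: thW => //; first exact/(wb' th).
  by rewrite (inv phi wb').
exists Q; split=> // [th thb||]; apply: FQ.
- by exists th.
- by exists (Neg Bot).
- by exists (Neg Bot).
Qed.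

Lemma not_finitely_satisfiable : ~ finitely_satisfiable_in N0 p ->
  exists m (psi : formula L ('I_n + 'I_m)) (c : 'I_m -> U), p (plug psi c) /\
    forall u : 'I_n -> U, (forall i, N0 (u i)) -> ~ sat psi (assign u c).
Proof.
apply: contra_notP => N phi; have [m [c [psi ->]]] := finite_support_plug phi.
move=> pphi; apply: contrapT => N'; apply: N; exists m, psi, c; split=> // u uN su.
by apply: N'; exists u; split=> //; rewrite sat_plug.
Qed.

(** Only a finite set of entries of [u] matters at a time. It has a copy in [N0] with the same type
    over [M], where [psi] fails with [c]; an automorphism fixing [M] carries the copy back, and the
    image of [c] is the required point. *)
Lemma not_finitely_satisfiable_ultra m (psi : formula L ('I_n + 'I_m)) (c : 'I_m -> U) :
  (forall u : 'I_n -> U, (forall i, N0 (u i)) -> ~ sat psi (assign u c)) ->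
  exists D, [/\ ultra D,
    forall th : formula L ('I_m + M), sat th (assign c (fun a : M => val a)) ->
      D (fun y => sat th (assign y (fun a : M => val a))) &
    forall u : 'I_n -> U, D (fun y => ~ sat psi (assign u y))].
Proof.
set v := (fun a : M => val a) => H.
pose F (W : set ('I_m -> U)) := exists (th : formula L ('I_m + M)) (S : set U),
  [/\ sat th (assign c v), finite_set S & forall y, sat th (assign y v) ->
    (forall u : 'I_n -> U, (forall i, S (u i)) -> ~ sat psi (assign u y)) -> W y].
have [|||D [uD FD]] := @ultra_extend _ F.
- by exists (Neg Bot), set0; split.
- move=> W W' [th [S [thc fS thW]]] [th' [S' [thc' fS' thW']]].
  exists (And th th'), (S `|` S'); rewrite sat_And finite_setU; split=> // y.
  rewrite sat_And => -[? ?] SS'.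
  by split; [apply: thW|apply: thW'] => // u uS; apply: SS' => i; [left|right].
- move=> W [th [S [thc /finite_range[k [w ->]] thW]]].
  have [w' [w'N w'w]] := N0P w.
  have [s [sa sM' sw]] := same_type_automorphism hU sM w'w.
  exists (s \o c); apply: thW => [|u uw].
    have -> : assign (s \o c) v = s \o assign c v.
      by apply/funext => -[//|a] /=; rewrite sM' //; exact: set_valP.
    by rewrite sat_automorphism.
  have /choice[t tP] : forall i, exists j, w j = u i by move=> i; have [j _] := uw i; exists j.
  have -> : assign u (s \o c) = s \o assign (w' \o t) c.
    by apply/funext => -[i|//] /=; rewrite sw tP.
  by rewrite sat_automorphism //; apply: H => i; exact: w'N.
exists D; split=> // [th thc|u]; apply: FD.
  by exists th, set0; split.
exists (Neg Bot), (range u); split=> //; first exact/finite_image/finite_finset.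
by move=> y _; apply => i; exists i.
Qed.

(** * Joining the two ultrafilters with a realization of the type *)

Section TwoSequences.
Variables (mz my : nat).
Variables (phi : formula L ('I_n + 'I_mz)) (b : 'I_mz -> U).
Variables (psi : formula L ('I_n + 'I_my)) (c : 'I_my -> U).
Hypotheses (pb : p (plug phi b)) (pc : p (plug psi c)).
Variable Q : set (set ('I_mz -> U)).
Hypotheses (uQ : ultra Q)
  (Qb : forall th : formula L ('I_mz + M), sat th (assign b (fun a : M => val a)) ->
      Q (fun b' => sat th (assign b' (fun a : M => val a))))
  (Qphi : Q (fun b' => ~ p (plug phi b')))
  (QN0 : Q (fun b' => forall i, N0 (b' i))).
Variable D : set (set ('I_my -> U)).
Hypotheses (uD : ultra D)
  (Dc : forall th : formula L ('I_my + M), sat th (assign c (fun a : M => val a)) ->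
      D (fun y => sat th (assign y (fun a : M => val a))))
  (Dpsi : forall u : 'I_n -> U, D (fun y => ~ sat psi (assign u y))).

Lemma realize_ultra_over (A : set U) m (F : set (set ('I_m -> U))) (e : 'I_m -> U) :
  small K A -> M `<=` A -> ultra F ->
  (forall th : formula L ('I_m + M), sat th (assign e (fun a : M => val a)) ->
      F (fun y => sat th (assign y (fun a : M => val a)))) ->
  exists e', same_type M e' e /\ forall th : formula L ('I_m + A),
    F (fun y => sat th (assign y (fun a : A => val a))) <->
    sat th (assign e' (fun a : A => val a)).
Proof.
move=> sA MA uF Fe; have [e' e'P] := realize_ultra hU sA uF; exists e'; split=> // th.
have [g gE] : exists g : M -> A, (fun a : M => val a) = val \o g.
  by apply: lift_set => a; apply: MA; exact: set_valP.
have := e'P (rename (fun s => match s with inl x => inl x | inr y => inr (g y) end) th).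
rewrite sat_rename (assign_comp id) -gE => <-.
rewrite [X in F X](_ : _ = fun y => sat th (assign y (fun a : M => val a))); last first.
  by apply/funext => y; rewrite sat_rename (assign_comp id) -gE.
split=> [Fth|]; last exact: Fe.
by apply: contrapT => /(Fe (Neg th))/(ultraN uF).
Qed.

(** Take [c'] generic for [D], then [b'] generic for [Q] over [c']. By invariance both instances are
    in [p], so some [x] satisfies them with [chi]. Its existence is a formula, and passes first from
    [b'] to almost all [z], then from [c'] to almost all [y]. *)
Lemma joint_realization chi : p chi ->
  Q (fun z => D (fun y => exists x : 'I_n -> U, [/\ sat chi (assign x id),
    sat phi (assign x z) & sat psi (assign x y)])).
Proof.
have [k [g [chi0 ->]]] := finite_support_plug chi => pchi.
pose joint (B : Type) (G : 'I_k -> B) z y : formula L B :=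
  exb (And (plug chi0 G) (And (plug phi z) (plug psi y))).
have jointP (B : Type) (G : 'I_k -> B) z y (w : B -> U) : sat (joint B G z y) w <->
    exists x : 'I_n -> U, [/\ sat chi0 (assign x (w \o G)),
      sat phi (assign x (w \o z)) & sat psi (assign x (w \o y))].
  rewrite sat_exb; split=> -[x xP]; exists x; move: xP; rewrite !sat_And !sat_plug.
    by move=> [? [? ?]].
  by move=> [].
pose A := N0 `|` range g.
have sA : small K A.
  by apply: (small_setU hU) => //; apply: (small_finite hU); exact/finite_image/finite_finset.
have [|c' [c'c c'D]] := realize_ultra_over sA _ uD Dc.
  by move=> x /MN0; left.
pose B := A `|` range c'.
have sB : small K B.
  by apply: (small_setU hU) => //; apply: (small_finite hU); exact/finite_image/finite_finset.
have [|b' [b'b b'Q]] := realize_ultra_over sB _ uQ Qb.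
  by move=> x /MN0; left; left.
have [gA gAE] : exists g' : 'I_k -> A, g = val \o g'.
  by apply: lift_set => i; right; exists i.
have [gB gBE] : exists g' : 'I_k -> B, g = val \o g'.
  by apply: lift_set => i; left; right; exists i.
have [c'B c'BE] : exists c'' : 'I_my -> B, c' = val \o c''.
  by apply: lift_set => i; right; exists i.
have Qj : Q (fun z => sat (joint _ (inr \o gB) inl (inr \o c'B)) (assign z (fun a : B => val a))).
  rewrite b'Q jointP.
  have [||x [x1 x2 x3]] := type_sat3 hp pchi (b := plug phi b') (c := plug psi c').
  - by apply/(inv _ b'b).
  - by apply/(inv _ c'c).
  move: x1 x2 x3; rewrite !sat_plug => x1 x2 x3; exists x; split.
  - by move: x1; rewrite gBE.
  - exact: x2.
  - by move: x3; rewrite c'BE.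
(* Here [Q] has to live on [N0]: then [z] is among the parameters [A] over which [c'] is generic for
   [D]. *)
apply: ultraS (ultraI uQ QN0 Qj) => // z [zN0]; rewrite jointP => -[x [x1 x2 x3]].
have [zA zAE] : exists z' : 'I_mz -> A, z = val \o z'.
  by apply: lift_set => i; left.
have : D (fun y => sat (joint _ (inr \o gA) (inr \o zA) inl) (assign y (fun a : A => val a))).
  rewrite c'D jointP; exists x; split.
  - by move: x1; rewrite -[_ \o _]/(val \o gB) -gBE gAE.
  - by move: x2; rewrite -[_ \o _]/z zAE.
  - by move: x3; rewrite -[_ \o _]/(val \o c'B) -c'BE.
apply: ultraS => // y; rewrite jointP => -[x' [x1' x2' x3']]; exists x'.
rewrite sat_plug; split.
- by rewrite gAE.
- by rewrite zAE.
- by [].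
Qed.

(** The distribution of the triple (x, y_0, z_0): its projection to (y, z) is prescribed, and
    [joint_realization] supplies the [x] that makes the requirements consistent. *)
Lemma joint_ultra : exists E : set (set (('I_n -> U) * ('I_my -> U) * ('I_mz -> U))),
  [/\ ultra E,
    forall S : ('I_my -> U) -> ('I_mz -> U) -> Prop,
      E (fun a => S a.1.2 a.2) <-> Q (fun z => D (fun y => S y z)),
    forall chi, p chi -> E (fun a => sat chi (assign a.1.1 id)),
    E (fun a => sat phi (assign a.1.1 a.2)) &
    E (fun a => sat psi (assign a.1.1 a.1.2))].
Proof.
pose F (W : set (('I_n -> U) * ('I_my -> U) * ('I_mz -> U))) :=
  exists (S : ('I_my -> U) -> ('I_mz -> U) -> Prop) chi,
  [/\ Q (fun z => D (fun y => S y z)), p chi & forall x y z, S y z ->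
    sat chi (assign x id) -> sat phi (assign x z) -> sat psi (assign x y) ->
    W (x, y, z)].
have pT : p (Neg Bot) by apply: (type_imp hp _ pb pb) => v _ _ /=.
have QDT (S : ('I_my -> U) -> ('I_mz -> U) -> Prop) :
    (forall y z, S y z) -> Q (fun z => D (fun y => S y z)).
  by move=> H; apply: ultra_true => // z; apply: ultra_true.
have [|||E [uE FE]] := @ultra_extend _ F.
- by exists (fun _ _ => True), (Neg Bot); split => //; exact: QDT.
- move=> W W' [S [chi [QS pchi H]]] [S' [chi' [QS' pchi' H']]].
  exists (fun y z => S y z /\ S' y z), (And chi chi'); split.
  + by apply: ultraS (ultraI uQ QS QS') => // z []; exact: ultraI.
  + exact: type_And.
  + by move=> x y z [? ?]; rewrite sat_And => -[? ?] ? ?; split; [apply: H|apply: H'].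
- move=> W [S [chi [QS pchi H]]].
  have /(ultra_ex uQ)[z [S1 S2]] := ultraI uQ QS (joint_realization pchi).
  have /(ultra_ex uD)[y [Syz [x [? ? ?]]]] := ultraI uD S1 S2.
  by exists (x, y, z); exact: H.
have EQ (S : ('I_my -> U) -> ('I_mz -> U) -> Prop) :
    Q (fun z => D (fun y => S y z)) -> E (fun a => S a.1.2 a.2).
  by move=> QS; apply: FE; exists S, (Neg Bot); split.
exists E; split=> // [S|chi pchi||].
- split=> [ES|]; last exact: EQ.
  apply: contrapT => /(ultraN uQ) N; move: ES; apply/(ultraN uE).
  by apply: (EQ (fun y z => ~ S y z)); apply: ultraS N => // z /(ultraN uD).
- by apply: FE; exists (fun _ _ => True), chi; split => //; exact: QDT.
- by apply: FE; exists (fun _ _ => True), (Neg Bot); split => //; exact: QDT.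
- by apply: FE; exists (fun _ _ => True), (Neg Bot); split => //; exact: QDT.
Qed.

(** * The two sequences and the bound on the dp-rank *)

Section Array.
Variable E : set (set (('I_n -> U) * ('I_my -> U) * ('I_mz -> U))).
Hypotheses (uE : ultra E)
  (EQD : forall S : ('I_my -> U) -> ('I_mz -> U) -> Prop,
      E (fun a => S a.1.2 a.2) <-> Q (fun z => D (fun y => S y z)))
  (Ep : forall chi, p chi -> E (fun a => sat chi (assign a.1.1 id)))
  (Ephi : E (fun a => sat phi (assign a.1.1 a.2)))
  (Epsi : E (fun a => sat psi (assign a.1.1 a.1.2))).

Let Omega : Type := (('I_n -> U) * (nat -> 'I_my -> U) * (nat -> 'I_mz -> U))%type.

(** Quantifiers over later elements are outermost, so the sequence [z] is read
    backwards from the list [zs]. Beyond index [k] the two sequences take the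
    junk values [c] and [b]. *)
Definition array_ultra k : set (set Omega) :=
  [set W | tpow Q k (fun zs => E (fun a => tpow D k (fun ys =>
     W (a.1.1, nth c (a.1.2 :: ys), nth b (a.2 :: rev zs)))))].

Lemma ultra_array k : ultra (array_ultra k).
Proof.
apply: (ultra_bind (ultra_tpow uQ k) (G := fun zs W => E (fun a => tpow D k (fun ys =>
     W (a.1.1, nth c (a.1.2 :: ys), nth b (a.2 :: rev zs)))))) => zs.
apply: (ultra_bind uE (G := fun a W => tpow D k (fun ys =>
     W (a.1.1, nth c (a.1.2 :: ys), nth b (a.2 :: rev zs))))) => a.
exact: (ultra_preimage (fun ys => (a.1.1, nth c (a.1.2 :: ys), nth b (a.2 :: rev zs)))
  (ultra_tpow uD k)).
Qed.

(** Without [x], the quantifier [E] splits into [Q] and [D]: z_0 becomes the innermost term of the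
    [Q]-block and y_0 the outermost of the [D]-block. *)
Lemma array_xfree k (R : (nat -> 'I_my -> U) -> (nat -> 'I_mz -> U) -> Prop) :
  array_ultra k (fun w => R w.1.2 w.2) <->
  tpow Q k.+1 (fun zs => tpow D k.+1 (fun ys => R (nth c ys) (nth b (rev zs)))).
Proof.
rewrite tpow_rcons //; apply: (ultra_congr (ultra_tpow uQ k)) => zs.
rewrite (EQD (fun y z => tpow D k (fun ys => R (nth c (y :: ys)) (nth b (z :: rev zs))))).
by apply: (ultra_congr uQ) => z; rewrite rev_rcons.
Qed.

(** The right side is free of [i], so two increasing choices can be compared through it. [R] may use
    the whole other sequence, as mutual indiscernibility requires. *)
Lemma array_indiscernible_y k r (i : 'I_r -> nat)
    (R : (nat -> 'I_mz -> U) -> ('I_r -> 'I_my -> U) -> Prop) :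
  (forall x y : 'I_r, (x < y)%N -> (i x < i y)%N) -> (forall x, (i x <= k)%N) ->
  array_ultra k (fun w => R w.2 (w.1.2 \o i)) <->
  tpow Q k.+1 (fun zs => tpow D r (fun ys => R (nth b (rev zs)) (fun x => nth c ys x))).
Proof.
move=> iP ik; rewrite (array_xfree k (fun y z => R z (y \o i))).
apply: (ultra_congr (ultra_tpow uQ k.+1)) => zs.
rewrite -(tpow_incr uD (k := k.+1) c _ iP ik).
by apply: (ultra_congr (ultra_tpow uD k.+1)) => ys; rewrite nth_map_enum.
Qed.

Lemma array_indiscernible_z k r (i : 'I_r -> nat)
    (R : (nat -> 'I_my -> U) -> ('I_r -> 'I_mz -> U) -> Prop) :
  (forall x y : 'I_r, (x < y)%N -> (i x < i y)%N) -> (forall x, (i x <= k)%N) ->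
  array_ultra k (fun w => R w.1.2 (w.2 \o i)) <->
  tpow Q r (fun zs => tpow D k.+1 (fun ys => R (nth c ys) (fun x => nth b (rev zs) x))).
Proof.
move=> iP ik; rewrite (array_xfree k (fun y z => R y (z \o i))).
rewrite -(tpow_incr_rev uQ (k := k.+1) b
  (fun zs => tpow D k.+1 (fun ys => R (nth c ys) (fun x => nth b zs x))) iP ik).
apply: (ultra_congr (ultra_tpow uQ k.+1)) => zs.
by rewrite nth_map_enum.
Qed.

(** Passing to the limit in [k] makes both sequences infinite: the sets that are large for all large
    [k] form a proper filter. *)
Lemma array_limit : exists G : set (set Omega), ultra G /\
  forall W, (exists k0, forall k, (k0 <= k)%N -> array_ultra k W) -> G W.
Proof.
pose F (W : set Omega) := exists k0, forall k, (k0 <= k)%N -> array_ultra k W.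
have [|||G [uG FG]] := @ultra_extend _ F.
- by exists 0 => k _; apply: (ultra_true (ultra_array k)).
- move=> W W' [k WP] [k' W'P]; exists (maxn k k') => i.
  by rewrite geq_max => /andP[/WP ? /W'P ?]; exact: (ultraI (ultra_array i)).
- by move=> W [k /(_ k (leqnn k))/(ultra_ex (ultra_array k))].
by exists G; split=> // W /FG.
Qed.

Lemma dp_rank_contradiction : ~ dp_rank_le 1 p.
Proof.
move=> dp; have [G [uG GP]] := array_limit.
pose N := upow U G.
pose a i : N := cls G (fun w => w.1.1 i).
pose ysq (j : nat) l : N := cls G (fun w => w.1.2 j l).
pose zsq (j : nat) l : N := cls G (fun w => w.2 j l).
have bound r (i j : 'I_r -> nat) : exists k0, forall x, (i x <= k0)%N /\ (j x <= k0)%N.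
  exists (\max_(x < r) (i x + j x)) => x; split.
    by apply: leq_trans (leq_bigmax x); exact: leq_addr.
  by apply: leq_trans (leq_bigmax x); exact: leq_addl.
have ap chi : p chi -> sat chi (assign a (diag G)).
  move=> pchi; have -> : assign a (diag G) =
      cls G \o assign (fun i w => w.1.1 i) (fun u => fun=> u).
    by apply/funext => -[].
  apply/sat_upow => //; apply: GP; exists 0 => k _.
  apply: (ultra_true (ultra_tpow uQ k)) => zs; apply: ultraS (Ep pchi) => // x H.
  apply: (ultra_true (ultra_tpow uD k)) => ys; move: H; congr (sat chi _).
  by apply/funext => -[].
have yI : indiscernible (N := N) (range (diag G) `|` entries zsq) ysq.
  apply: (indiscernible_upow (s := fun w => w.1.2) (t := fun w : Omega => w.2)) => //.
    move=> x [[u _ <-]|[j [l ->]]]; first by exists (fun=> u).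
    by exists (fun z => z j l).
  (* [GP] is only an implication, so the equivalence is first moved inside the ultrafilter. *)
  move=> r i j R iP jP; apply/(ultra_iff uG); apply: GP.
  have [k0 k0P] := bound r i j; exists k0 => k k0k.
  apply/(ultra_iff (ultra_array k)); rewrite !array_indiscernible_y // => x.
    by apply: leq_trans k0k; case: (k0P x).
  by apply: leq_trans k0k; case: (k0P x).
have zI : indiscernible (N := N) (range (diag G) `|` entries ysq) zsq.
  apply: (indiscernible_upow (s := fun w => w.2) (t := fun w : Omega => w.1.2)) => //.
    move=> x [[u _ <-]|[j [l ->]]]; first by exists (fun=> u).
    by exists (fun z => z j l).
  move=> r i j R iP jP; apply/(ultra_iff uG); apply: GP.
  have [k0 k0P] := bound r i j; exists k0 => k k0k.
  apply/(ultra_iff (ultra_array k)); rewrite !array_indiscernible_z // => x.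
    by apply: leq_trans k0k; case: (k0P x).
  by apply: leq_trans k0k; case: (k0P x).
have satE m (th : formula L ('I_n + 'I_m)) (s : Omega -> 'I_m -> U) :
    (exists k0, forall k, (k0 <= k)%N -> array_ultra k (fun w => sat th (assign w.1.1 (s w)))) ->
    sat th (assign a (fun l => cls G (fun w => s w l))).
  move=> /GP H.
  have -> : assign a (fun l => cls G (fun w => s w l)) =
      cls G \o assign (fun i w => w.1.1 i) (fun l w => s w l) by apply/funext => -[].
  apply/sat_upow => //; apply: ultraS H => // w; congr (sat th _).
  by apply/funext => -[].
have y0 : sat psi (assign a (ysq 0)).
  apply: (satE _ psi (fun w => w.1.2 0)); exists 0 => k _.
  apply: (ultra_true (ultra_tpow uQ k)) => zs; apply: ultraS Epsi => // x H.
  exact: (ultra_true (ultra_tpow uD k)).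
have y1 : ~ sat psi (assign a (ysq 1)).
  (* Index 1 is the first term of [ys], bound inside the triple, so [Dpsi] applies with [x] fixed.
     For [k = 0] the entry would be the junk value [c]. *)
  apply: (satE _ (Neg psi) (fun w => w.1.2 1)); exists 1 => -[//|k] _.
  apply: (ultra_true (ultra_tpow uQ k.+1)) => zs; apply: (ultra_true uE) => x.
  rewrite tpowS; apply: ultraS (Dpsi x.1.1) => // y H.
  exact: (ultra_true (ultra_tpow uD k)).
have z0 : sat phi (assign a (zsq 0)).
  apply: (satE _ phi (fun w => w.2 0)); exists 0 => k _.
  apply: (ultra_true (ultra_tpow uQ k)) => zs; apply: ultraS Ephi => // x H.
  exact: (ultra_true (ultra_tpow uD k)).
have z1 : ~ sat phi (assign a (zsq 1)).
  (* Index 1 is the last term of [zs], bound just outside the triple: with [z] fixed, the negation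
     of [phi(x; z)] is a formula of [p], and [Ep] applies. *)
  apply: (satE _ (Neg phi) (fun w => w.2 1)); exists 1 => -[//|k] _.
  apply/(tpow_rcons uQ); apply: (ultra_true (ultra_tpow uQ k)) => zs.
  apply: ultraS Qphi => // z /(typeN hp)/Ep; apply: ultraS => // x H.
  apply: (ultra_true (ultra_tpow uD k.+1)) => ys; move: H.
  by rewrite rev_rcons !satN sat_plug.
(* The tuple lengths differ, so the family is dependent; a boolean index, read off from [k == ord0],
   lets the types agree by computation. *)
pose I (y : bool) := if y return nat -> 'I_(if y then my else mz) -> N then ysq else zsq.
pose J (k : 'I_2) : orderType _ := nat.
pose m (k : 'I_2) := if k == ord0 then my else mz.
have IP (A : set N) y : A `<=` range (diag G) `|` entries (I (~~ y)) ->
    indiscernible A (I y).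
  by case: y => AS; [apply: indiscernible_sub yI|apply: indiscernible_sub zI].
have [||k] := dp N (diag G) (diag_elementary uG) a ap _ J m (fun k => I (k == ord0)).
- by move=> k; exact: infinite_nat.
- move=> k; apply: IP => x [|[l /= lk] xI]; first by left.
  right; suff <- : (l == ord0) = ~~ (k == ord0) by [].
  by case: l k lk xI => [[|[|//]] ?] [[|[|//]] ?].
have aA i : (range (diag G) `|` range a) (a i) by right; exists i.
rewrite /m; case: (k == ord0) => AI.
- by apply/y1/(indiscernible_sat psi 0 1 AI aA).
- by apply/z1/(indiscernible_sat phi 0 1 AI aA).
Qed.

End Array.
End TwoSequences.
End Core.

Theorem theorem4p2 (L : language) (hL : countable_language L)
    (T : theory L) (hT : complete_theory T)
    (K : Type) (U : structure L) (hUT : models U T) (hU : monster K U)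
    (n : nat) (p : set (formula L ('I_n + U))) (hp : global_type p)
    (hinv : exists M : set U, small_model K M /\ invariant_over M p)
    (hdp : dp_rank_le 1 p) :
  (exists M : set U, small_model K M /\ finitely_satisfiable_in M p) \/
  (exists M : set U, small_model K M /\ definable_over M p).
Proof.
have [M [smM pM]] := hinv; have sM := smM.1.
have [N0 [smN0 MN0 N0P]] := small_model_realizing hL hU smM.
(* Finite satisfiability is tested in the larger model [N0], definability over [M]: both
   ultrafilters extend types over [M], and their construction uses tuples of [N0]. *)
have [fs|nfs] := pselect (finitely_satisfiable_in N0 p); first by left; exists N0.
have [df|ndf] := pselect (definable_over M p); first by right; exists M.
have [mz [phi [b [pb bP]]]] := not_definable hU hp sM ndf.
have [Q [uQ Qb Qphi QN0]] := not_definable_ultra hp pM N0P bP.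
have [my [psi [c [pc cP]]]] := not_finitely_satisfiable nfs.
have [D [uD Dc Dpsi]] := not_finitely_satisfiable_ultra hU sM N0P cP.
have [E [uE EQD Ep Ephi Epsi]] :=
  joint_ultra hU hp pM smN0.1 MN0 pb pc uQ Qb QN0 uD Dc.
by have := dp_rank_contradiction hp b c uQ Qphi uD Dpsi uE EQD Ep Ephi Epsi hdp.
Qed.
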